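(* There exist exactly fifty-eight equivalence classes of square free monomial Cremona transformations of $\mathbb{P}^5$. That is, counting over all degrees $d$, there are exactly $58$ equivalence classes, under the natural action of the symmetric group $S_6$, of Cremona sets $F\subset \mathbb{K}[x_1,\ldots,x_6]$ consisting of $6$ square free monomials of the same degree $d$.
   Context: $\mathbb{K}$ is a field. A monomial $f\in\mathbb{K}[x_1,\ldots,x_n]$ is square free if $x_i^2\nmid f$ for all $i$. A set $F=\{f_1,\ldots,f_n\}$ of $n$ (distinct) monomials in $\mathbb{K}[x_1,\ldots,x_n]$ of the same degree $d\ge 1$ defines the rational map $\varphi_F:\mathbb{P}^{n-1}\dashrightarrow\mathbb{P}^{n-1}$, $\varphi_F(\underline{x})=(f_1(\underline{x}):\cdots:f_n(\underline{x}))$. $F$ is called a Cremona set if $\varphi_F$ is a Cremona transformation (a birational map); algebraically, if the inclusion $\mathbb{K}[f_1,\ldots,f_n]\subset \mathbb{K}[\underline{x}_d]$ becomes an equality at the level of fields of fractions, where $\mathbb{K}[\underline{x}_d]$ is the Veronese algebra generated by all monomials of degree $d$ in $x_1,\ldots,x_n$. The order of the elements in $F$ is irrelevant. The group $S_n$ acts on monomials by permuting the variables, $\sigma * (x_1^{a_1}\cdots x_n^{a_n})=x_{\sigma(1)}^{a_1}\cdots x_{\sigma(n)}^{a_n}$, and on sets of monomials elementwise; two Cremona sets are equivalent if they lie in the same $S_n$-orbit. Equivalence classes of square free monomial Cremona transformations of $\mathbb{P}^{n-1}$ are the equivalence classes of Cremona sets of $n$ square free monomials in $\mathbb{K}[x_1,\ldots,x_n]$.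 *)

(* Defs.v *)
From HB Require Import structures.
From mathcomp Require Import all_boot all_order all_fingroup all_algebra.
From mathcomp Require Import finmap.
From mathcomp.multinomials Require Import mpoly.

Set Implicit Arguments.
Unset Strict Implicit.
Unset Printing Implicit Defensive.

Import GRing.Theory.
Local Open Scope ring_scope.
Local Open Scope fset_scope.

(* K[S], the unital K-subalgebra generated by a subset S of A *)
Inductive subalg_gen (K : fieldType) (A : algType K) (S : A -> Prop) :
  A -> Prop :=
| SubalgGen a of S a : subalg_gen S a
| SubalgScalar (c : K) : subalg_gen S c%:A
| SubalgAdd a b of subalg_gen S a & subalg_gen S b : subalg_gen S (a + b)
| SubalgMul a b of subalg_gen S a & subalg_gen S b : subalg_gen S (a * b).

(* The fraction field of a subring B of a domain R, inside Frac R *)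
Definition frac_field (R : idomainType) (B : R -> Prop) (z : {fraction R}) :
  Prop :=
  exists a b : R, [/\ B a, B b, b != 0 & z = tofrac a / tofrac b].

(* A monomial x_1^{m_1} ... x_n^{m_n} is encoded by its exponent vector
   m : 'X_{1..n}, and is the polynomial 'X_[m] of {mpoly K[n]}.           *)

Definition monomial_algebra (K : fieldType) (n : nat) (P : 'X_{1..n} -> Prop) :
  {mpoly K[n]} -> Prop :=
  subalg_gen (fun p : {mpoly K[n]} => exists2 m, P m & p = 'X_[m]).

Definition veronese_algebra (K : fieldType) (n d : nat) :
  {mpoly K[n]} -> Prop :=
  monomial_algebra (fun m : 'X_{1..n} => mdeg m = d).

(* Birationality of the rational map defined by F is expressed as the equality
   of the fraction fields of K[F] and of the d-th Veronese algebra, as subfields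
   of K(x_1, ..., x_n).                                                     *)
Definition cremona_set (K : fieldType) (n : nat) (F : {fset 'X_{1..n}}) : Prop :=
  #|` F| = n /\
  exists d : nat,
    [/\ (0 < d)%N,
        forall m, m \in F -> mdeg m = d
      & forall z : {fraction {mpoly K[n]}},
          frac_field (monomial_algebra (fun m => m \in F)) z <->
          frac_field (@veronese_algebra K n d) z].

(* lem, written (_ <= _)%MM, is divisibility of monomials *)
Definition square_free (n : nat) (m : 'X_{1..n}) : Prop :=
  forall i : 'I_n, ~~ (U_(i) *+ 2 <= m)%MM.

(* x_1^{m_1} ... x_n^{m_n} is sent to x_{s 1}^{m_1} ... x_{s n}^{m_n}:
   the exponent of x_j in the image is m_{s^-1 j}.                          *)
Definition monomial_perm (n : nat) (s : 'S_n) (m : 'X_{1..n}) : 'X_{1..n} :=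
  [multinom m ((s^-1)%g j) | j < n].

Lemma monomial_permE (n : nat) (s : 'S_n) (m : 'X_{1..n}) (i : 'I_n) :
  monomial_perm s m (s i) = m i.
Proof. by rewrite mnmE permK. Qed.

Definition set_perm (n : nat) (s : 'S_n) (F : {fset 'X_{1..n}}) :
  {fset 'X_{1..n}} :=
  [fset monomial_perm s m | m in F].

(* The S_n-orbit of F, i.e. its equivalence class *)
Definition perm_class (n : nat) (F : {fset 'X_{1..n}}) :
  {fset {fset 'X_{1..n}}} :=
  [fset set_perm s F | s in [set: 'S_n]].

Definition square_free_cremona_class (K : fieldType) (n : nat)
    (c : {fset {fset 'X_{1..n}}}) : Prop :=
  exists F : {fset 'X_{1..n}},
    [/\ cremona_set K F,
        forall m, m \in F -> square_free m
      & c = perm_class F].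

(* Main.v *)
Require Import Defs.
From HB Require Import structures.
From mathcomp Require Import all_boot all_order all_fingroup all_algebra.
From mathcomp Require Import finmap.
From mathcomp.multinomials Require Import mpoly.

(* Let d be the common degree of F and let L be the lattice of integer vectors
   of degree divisible by d.  Comparing supports in X^m * b = a with a, b in
   K[F] shows that F is a Cremona set iff the exponent vectors of F generate L;
   in suitable coordinates of L this says that an integer matrix has
   determinant 1 or -1.  The sets of k square free monomials of degree d are
   classified up to permutation of the variables by induction on k, adding one
   monomial to each representative and discarding redundant sets; this leaves
   1, 21, 94, 21, 1 classes of sextuples for d = 1, ..., 5, of which
   1, 8, 40, 8, 1 are unimodular.                                            *)

Set Implicit Arguments.
Unset Strict Implicit.
Unset Printing Implicit Defensive.

Import GRing.Theory.
Local Open Scope ring_scope.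

(** * Fraction fields of monomial algebras *)

(** Multiplicities form a function on all monomials, so they add pointwise and need no index type
    depending on [s]. *)
Definition nat_comb n (s : seq 'X_{1..n}) (c : 'X_{1..n} -> nat) : 'X_{1..n} :=
  (\sum_(m <- s) m *+ c m)%MM.

Lemma nat_combE n s c (i : 'I_n) :
  nat_comb s c i = (\sum_(m <- s) m i * c m)%N.
Proof. by rewrite /nat_comb mnm_sumE; apply: eq_bigr => m _; rewrite mulmnE. Qed.

Lemma nat_combD n (s : seq 'X_{1..n}) c1 c2 :
  (nat_comb s c1 + nat_comb s c2)%MM = nat_comb s (fun m => c1 m + c2 m)%N.
Proof.
apply/mnmP => i; rewrite mnmDE !nat_combE -big_split /=.
by apply: eq_bigr => m _; rewrite mulnDr.
Qed.

Lemma nat_comb1 n (s : seq 'X_{1..n}) m :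
  uniq s -> m \in s -> m = nat_comb s (fun k => k == m).
Proof.
move=> s_uniq sm; apply/mnmP => i; rewrite nat_combE (bigD1_seq m) //= eqxx muln1.
by rewrite big1 ?addn0 // => k /negPf->; rewrite muln0.
Qed.

Lemma mdeg_nat_comb n (s : seq 'X_{1..n}) c d :
  {in s, forall m, mdeg m = d} ->
  mdeg (nat_comb s c) = (d * \sum_(m <- s) c m)%N.
Proof.
move=> sd; rewrite /nat_comb mdeg_sum big_distrr /= !big_seq.
by apply: eq_bigr => m /sd dm; rewrite mdegMn dm.
Qed.

Section MonomialAlgebra.
Variables (K : fieldType) (n : nat).
Implicit Types (s : seq 'X_{1..n}) (S : {mpoly K[n]} -> Prop).

Lemma monomial_algebra_nat_comb s c :
  monomial_algebra (fun m => m \in [fset m in s]%fset) ('X_[nat_comb s c] : {mpoly K[n]}).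
Proof.
pose B := @monomial_algebra K n (fun m => m \in [fset m in s]%fset).
have B1 : B 1 by rewrite -[1]scale1r; apply: SubalgScalar.
(* The induction runs over sublists [t], while the generating set stays that of the whole of [s]. *)
suff: forall t, {subset t <= s} -> B 'X_[nat_comb t c] by apply.
rewrite /nat_comb; elim=> [|m t IH] st; first by rewrite big_nil mpolyX0.
rewrite big_cons mpolyXD; apply: SubalgMul; last first.
  by apply: IH => k kt; apply: st; rewrite inE kt orbT.
rewrite -mpolyXn; elim: (c m) => [|k IHk]; first by rewrite expr0.
rewrite exprS; apply: SubalgMul => //; apply: SubalgGen.
by exists m => //; rewrite in_fset; apply: st; rewrite mem_head.
Qed.

(** Induction on the generation of [p]: the support of a sum lies in the union of the supports and
    that of a product in their Minkowski sum, so it never leaves the monoid generated by [s]. *)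
Lemma msupp_monomial_algebra s (p : {mpoly K[n]}) m :
  uniq s -> monomial_algebra (fun m => m \in [fset m in s]%fset) p -> m \in msupp p ->
  exists c, m = nat_comb s c.
Proof.
move=> s_uniq Bp; elim: Bp m => {p}.
- move=> p [k + ->] m; rewrite in_fset msuppX inE => sk /eqP->.
  by exists (fun l => l == k); apply: nat_comb1.
- move=> c m /msuppZ_le; rewrite msupp1 inE => /eqP->.
  by exists (fun=> 0%N); apply/mnmP => i; rewrite nat_combE mnm0E big1 // => k; rewrite muln0.
- by move=> p q _ IHp _ IHq m /msuppD_le; rewrite mem_cat => /orP[/IHp|/IHq].
- move=> p q _ IHp _ IHq m /msuppM_le /allpairsP[[a b] /= [/IHp[c ->] /IHq[e ->] ->]].
  by rewrite nat_combD; eexists.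
Qed.

(** Elements whose image lies in the fraction field of K[S] are closed under sums and products and
    contain the scalars, so an inclusion of fraction fields can be tested on generators. *)
Lemma frac_field_gen S S' :
  (forall a, S' a -> frac_field (subalg_gen S) (tofrac a)) ->
  forall z, frac_field (subalg_gen S') z -> frac_field (subalg_gen S) z.
Proof.
pose B := subalg_gen S; have B1 : B 1 by rewrite -[1]scale1r; apply: SubalgScalar.
move=> S'B; have {S'B}gen a : subalg_gen S' a -> frac_field B (tofrac a).
  elim=> {a} [//|c|a b _ Fa _ Fb|a b _ Fa _ Fb].
  - by exists c%:A, 1; split; rewrite ?oner_neq0 ?tofrac1 ?divr1 //; apply: SubalgScalar.
  - case: Fa Fb => [a1 [a2 [Ba1 Ba2 nza Ea]]] [b1 [b2 [Bb1 Bb2 nzb Eb]]].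
    exists (a1 * b2 + b1 * a2), (a2 * b2); split; rewrite ?mulf_neq0 //.
    + by apply: SubalgAdd; apply: SubalgMul.
    + exact: SubalgMul.
    + by rewrite tofracD Ea Eb addf_div ?tofrac_eq0 // tofracD !tofracM.
  - case: Fa Fb => [a1 [a2 [Ba1 Ba2 nza Ea]]] [b1 [b2 [Bb1 Bb2 nzb Eb]]].
    exists (a1 * b1), (a2 * b2); split; rewrite ?mulf_neq0 //.
    + exact: SubalgMul.
    + exact: SubalgMul.
    + by rewrite [LHS](tofracM a b) Ea Eb !tofracM mulf_div.
move=> z [a [b [/gen[a1 [a2 [Ba1 Ba2 nza Ea]]] /gen[b1 [b2 [Bb1 Bb2 nzb Eb]]] nz ->]]].
exists (a1 * b2), (a2 * b1); split; try exact: SubalgMul.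
  rewrite mulf_neq0 //; apply: contraNneq nz => b10.
  by rewrite -tofrac_eq0 Eb b10 tofrac0 mul0r.
by rewrite Ea Eb !tofracM invf_div mulf_div.
Qed.

(** The right-hand condition puts every monomial of degree [d] in the group generated by the
    exponent vectors of [s], stated with natural coefficients on both sides instead of integer
    ones. *)
Lemma frac_field_veroneseP s d :
    uniq s -> {in s, forall m, mdeg m = d} ->
  (forall z : {fraction {mpoly K[n]}},
      frac_field (monomial_algebra (fun m => m \in [fset m in s]%fset)) z <->
      frac_field (@veronese_algebra K n d) z) <->
  (forall m, mdeg m = d ->
     exists a b, (m + nat_comb s a)%MM = nat_comb s b).
Proof.
move=> s_uniq sd; have mono1 (P : 'X_{1..n} -> Prop) : @monomial_algebra K n P 1.
  by rewrite -[1]scale1r; apply: SubalgScalar.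
split=> [eqF m dm|comb z].
  have [_] := eqF (tofrac 'X_[m]); case.
    exists 'X_[m], 1; split; rewrite ?oner_neq0 ?tofrac1 ?divr1 //; last exact: mono1.
    by apply: SubalgGen; exists m.
  move=> p [q [Bp Bq nzq Epq]].
  have {}Epq : 'X_[m] * q = p.
    apply/eqP; rewrite -tofrac_eq tofracM Epq.
    by rewrite mulfVK ?tofrac_eq0.
  (* Any monomial in the support of [q] would do; the leading one exists because [q] is nonzero, and
     its shift by [m] lies in the support of [p]. *)
  have [a Ea] := msupp_monomial_algebra s_uniq Bq (mlead_supp nzq).
  have [|b Eb] := @msupp_monomial_algebra s p (m + nat_comb s a)%MM s_uniq Bp.
    by rewrite -Epq mulrC -Ea mcoeff_msupp mcoeffMX -mcoeff_msupp mlead_supp.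
  by exists a, b.
split; apply: frac_field_gen => p [m Pm ->].
  exists 'X_[m], 1; split; rewrite ?oner_neq0 ?tofrac1 ?divr1 //; last exact: mono1.
  by apply: SubalgGen; exists m => //; move: Pm; rewrite in_fset; apply: sd.
have [a [b Eab]] := comb m Pm.
exists 'X_[nat_comb s b], 'X_[nat_comb s a]; split.
- exact: monomial_algebra_nat_comb.
- exact: monomial_algebra_nat_comb.
- by rewrite -msupp_eq0 msuppX.
- by rewrite -Eab mpolyXD tofracM mulfK // tofrac_eq0 -msupp_eq0 msuppX.
Qed.

End MonomialAlgebra.

(** * Lattices of exponent vectors and determinants *)

(* The exponent matrix in which the exponents of the variable 0 are replaced by
   1: v |-> (mdeg v / d, v_1, ..., v_n) is an isomorphism from the lattice of
   integer vectors of degree divisible by d onto Z^(n+1).                    *)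
Definition exponent_mx n (s : seq 'X_{1..n.+1}) : 'M[int]_n.+1 :=
  \matrix_(i, j) if j == 0 then 1 else (nth 0%MM s i j)%:Z.

Section Lattice.
Variables (n d : nat) (s : seq 'X_{1..n.+1}).
Hypotheses (s_uniq : uniq s) (s_size : size s = n.+1) (d_gt0 : (0 < d)%N).
Hypothesis s_deg : {in s, forall m, mdeg m = d}.

Let big_s (R : nmodType) (F : 'X_{1..n.+1} -> R) :
  \sum_(m <- s) F m = \sum_(i < n.+1) F (nth 0%MM s i).
Proof. by rewrite (big_nth 0%MM) big_mkord s_size. Qed.

(** Exponent vectors of degree [d] generate the whole lattice, so reaching all of them means that
    the rows of the matrix span the integer row vectors. *)
Lemma lattice_exponent_mx :
  (forall m, mdeg m = d -> exists a b, (m + nat_comb s a)%MM = nat_comb s b) <->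
  exponent_mx s \in unitmx.
Proof.
split=> [comb|M_unit m dm].
  have comb_row m : mdeg m = d -> exists u : 'rV[int]_n.+1,
      u *m exponent_mx s = \row_j if j == 0 then 1 else (m j)%:Z.
    move=> dm; have [a [b Eab]] := comb m dm.
    exists (\row_i ((b (nth 0%MM s i))%:Z - (a (nth 0%MM s i))%:Z)).
    apply/rowP => j; rewrite !mxE; case: ifP => j0.
      under eq_bigr do rewrite !mxE j0 mulr1.
      rewrite -(big_s (fun m => (b m)%:Z - (a m)%:Z)) sumrB -!(big_morph _ PoszD (erefl _)).
      apply/eqP; rewrite subr_eq -PoszD; apply/eqP; congr Posz.
      apply/eqP; rewrite -(eqn_pmul2l d_gt0) mulnDr muln1 -!mdeg_nat_comb //.
      by rewrite -Eab mdegD dm.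
    under eq_bigr do rewrite !mxE j0 mulrBl -!PoszM !(mulnC _ (nth 0%MM s _ j)).
    rewrite -(big_s (fun m => (m j * b m)%:Z - (m j * a m)%:Z)) sumrB.
    rewrite -!(big_morph _ PoszD (erefl _)) -!nat_combE -Eab mnmDE PoszD.
    by rewrite addrK.
  have [u0 Eu0] : exists u : 'rV[int]_n.+1, u *m exponent_mx s = delta_mx 0 0.
    (* The d-th power of variable 0 has coordinates (1, 0, ..., 0). *)
    have [|u Eu] := comb_row (U_(ord0) *+ d)%MM; first by rewrite mdegMn mdeg1 mul1n.
    exists u; rewrite Eu; apply/rowP => j; rewrite !mxE mulmnE mnm1E /= eq_sym.
    by case: eqP.
  have /fin_all_exists[u Eu] (j : 'I_n.+1) :
      exists u : 'rV[int]_n.+1, u *m exponent_mx s = delta_mx 0 j.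
    have [->|j0] := eqVneq j 0; first by exists u0.
    (* This monomial has coordinates e_0 + e_j, and e_0 has just been reached. *)
    have [|u Eu] := comb_row (U_(ord0) *+ d.-1 + U_(j))%MM.
      by rewrite mdegD mdegMn !mdeg1 mul1n addn1 prednK.
    exists (u - u0); rewrite mulmxBl Eu Eu0; apply/rowP => k.
    rewrite !mxE mnmDE mulmnE !mnm1E /= !(eq_sym _ k).
    have [->|_] := eqVneq k 0; first by rewrite subrr eq_sym (negPf j0).
    by rewrite subr0 mul0n add0n; case: (k == j).
  have /mulmx1_unit[] // : (\matrix_i u i) *m exponent_mx s = 1%:M.
  by apply/row_matrixP => i; rewrite row_mul rowK Eu rowE mulmx1.
pose r : 'rV[int]_n.+1 := \row_j if j == 0 then 1 else (m j)%:Z.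
pose u := r *m invmx (exponent_mx s).
have Eu j : \sum_(i < n.+1) u 0 i * exponent_mx s i j = r 0 j.
  by rewrite -[r in RHS](mulmxKV M_unit) mxE.
pose c k := u 0 (inord (index k s)).
have cE (i : 'I_n.+1) : c (nth 0%MM s i) = u 0 i.
  by rewrite /c index_uniq ?s_size // inord_val.
have c1 : \sum_(k <- s) c k = 1.
  have := Eu 0; rewrite /r !mxE /= => <-; rewrite big_s.
  by apply: eq_bigr => i _; rewrite cE !mxE mulr1.
have cj j : j != 0 -> \sum_(k <- s) c k * (k j)%:Z = (m j)%:Z.
  move=> /negPf j0; have := Eu j; rewrite /r !mxE j0 => <-; rewrite big_s.
  by apply: eq_bigr => i _; rewrite cE !mxE j0.
(* Column 0 of the matrix does not record the exponents of variable 0. They are recovered from the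
   total degree: the coefficients sum to 1 and all monomials have degree [d]. *)
have {}cj j : \sum_(k <- s) c k * (k j)%:Z = (m j)%:Z.
  have [->|/cj//] := eqVneq j 0.
  have : \sum_j \sum_(k <- s) c k * (k j)%:Z = \sum_j (m j)%:Z.
    rewrite -(big_morph _ PoszD (erefl _)) -mdegE dm exchange_big /=.
    transitivity (\sum_(k <- s) c k * d%:Z); last by rewrite -mulr_suml c1 mul1r.
    rewrite !big_seq; apply: eq_bigr => k sk.
    by rewrite -mulr_sumr -(big_morph _ PoszD (erefl _)) -mdegE s_deg.
  rewrite (bigD1 0) //= [RHS](bigD1 0) //= => /eqP.
  by rewrite (eq_bigr _ cj) (inj_eq (addIr _)) => /eqP.
(* Negative and positive parts of the integer coefficients; [Negz a] stands for -(a + 1). *)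
exists (fun k => if c k is Negz a then a.+1 else 0%N).
exists (fun k => if c k is Posz a then a else 0%N).
apply/mnmP => j; rewrite mnmDE !nat_combE; apply/eqP; rewrite -eqz_nat PoszD -cj.
rewrite !(big_morph _ PoszD (erefl _)) -big_split /=; apply/eqP/eq_bigr => k _.
case: (c k) => a; first by rewrite muln0 addr0 PoszM mulrC.
by rewrite muln0 NegzE mulNr -PoszM mulnC addNr.
Qed.

End Lattice.

(** Laplace expansion along the first row, on lists of rows so that it can be evaluated. *)
Fixpoint seq_det (R : comPzRingType) n (a : seq (seq R)) : R :=
  if n is m.+1 then
    foldr (fun j s => (-1) ^+ j * nth 0 (head [::] a) j *
             seq_det m [seq take j r ++ drop j.+1 r | r <- behead a] + s)
          0 (iota 0 n)
  else 1.

Lemma seq_detE (R : comPzRingType) n (a : seq (seq R)) :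
  size a = n -> all (fun r => size r == n) a ->
  seq_det n a = \det (\matrix_(i < n, j < n) nth 0 (nth [::] a i) j).
Proof.
elim: n a => [|n IH] [|r a] //; first by rewrite det_mx00.
case=> sa /andP[/eqP sr /allP sa_r]; rewrite (expand_det_row _ 0).
have -> : seq_det n.+1 (r :: a) = \sum_(j <- index_iota 0 n.+1)
    (-1) ^+ j * nth 0 r j * seq_det n [seq take j q ++ drop j.+1 q | q <- a].
  by rewrite unlock.
rewrite big_mkord; apply: eq_bigr => j _.
rewrite !mxE /= /cofactor add0n mulrAC mulrC; congr (_ * (_ * _)).
rewrite IH ?size_map //; last first.
  apply/allP => _ /mapP[q /sa_r/eqP sq ->].
  by rewrite size_cat size_drop size_take sq ltn_ord subSS subnKC // -ltnS.
congr (\det _); apply/matrixP => i k; rewrite !mxE /= (nth_map [::]) ?sa //.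
have /sa_r/eqP sq : nth [::] a i \in a by rewrite mem_nth ?sa.
(* Deleting entry [j] of a row shifts the later entries by one, just as [bump] shifts column indices
   in a minor. *)
rewrite nth_cat size_take sq ltn_ord /bump; case: (leqP j k) => le_jk /=.
  by rewrite nth_drop addSn subnKC.
by rewrite nth_take.
Qed.

(** * Square free monomials and permutations of the variables *)

Fixpoint bitseqs n : seq bitseq :=
  if n is m.+1 then
    [seq true :: b | b <- bitseqs m] ++ [seq false :: b | b <- bitseqs m]
  else [:: [::]].

Lemma mem_bitseqs n b : (b \in bitseqs n) = (size b == n).
Proof.
elim: n b => [|n IH] [|c b] //=; rewrite mem_cat.
  by apply/negbTE/norP; split; apply/mapP => -[].
rewrite eqSS -IH; apply/orP/idP => [[]/mapP[? ? [_ ->]]//|bn].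
by case: c; [left | right]; apply: map_f.
Qed.

Definition monos n d : seq bitseq := [seq b <- bitseqs n | count id b == d].

(* Square free monomials are encoded by the bit vectors of their exponents, and
   sets of them by sequences without repetition. *)
Definition bmon n (b : bitseq) : 'X_{1..n} := [multinom nth false b i : nat | i < n].

Lemma mem_monos n d b : (b \in monos n d) = (size b == n) && (count id b == d).
Proof. by rewrite mem_filter mem_bitseqs andbC. Qed.

(** The length must be fixed, since [bmon] reads missing bits as [false] and ignores bits from
    position [n] on. *)
Lemma bmon_inj n : {in [pred b | size b == n] &, injective (bmon n)}.
Proof.
move=> b c /eqP sb /eqP sc /mnmP eq_bc; apply: (@eq_from_nth _ false); first by rewrite sb sc.
move=> i; rewrite sb => lt_i; have := eq_bc (Ordinal lt_i).
by rewrite !mnmE /=; do 2!case: nth.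
Qed.

Lemma mdeg_bmon n b : size b = n -> mdeg (bmon n b) = count id b.
Proof.
move=> sb; rewrite mdegE; under eq_bigr do rewrite mnmE.
rewrite -(big_mkord xpredT (fun i => nth false b i : nat)) -sb.
rewrite -(big_nth false xpredT (fun c : bool => c : nat)) -sum1_count [RHS]big_mkcond.
by apply: eq_bigr => -[].
Qed.

Lemma square_free_bmon n b : square_free (bmon n b).
Proof.
move=> i; apply/negP => /mnm_lepP/(_ i).
by rewrite mulmnE mnm1E mnmE eqxx; case: nth.
Qed.

Lemma square_freeP n d (m : 'X_{1..n}) :
  square_free m -> mdeg m = d -> exists2 b, b \in monos n d & m = bmon n b.
Proof.
move=> sfm dm; pose b := [seq (0 < m i)%N | i <- enum 'I_n].
have sb : size b = n by rewrite size_map size_enum_ord.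
have Em : m = bmon n b.
  apply/mnmP => i; rewrite mnmE (nth_map i) ?size_enum_ord // nth_ord_enum.
  have := sfm i; case: (posnP (m i)) => [->//|m_gt0] /mnm_lepP lt2.
  apply/eqP; rewrite eqn_leq m_gt0 andbT leqNgt; apply/negP => m_gt1; case: lt2 => j.
  by rewrite mulmnE mnm1E; case: eqP => [<-|].
by exists b; rewrite // mem_monos sb -dm Em mdeg_bmon ?eqxx.
Qed.

Definition bset n (x : seq bitseq) : {fset 'X_{1..n}} := [fset m in map (bmon n) x]%fset.

Lemma in_bset n x m : (m \in bset n x) = (m \in map (bmon n) x).
Proof. by rewrite in_fset. Qed.

Lemma monos_size n d b : b \in monos n d -> b \in [pred b : bitseq | size b == n].
Proof. by rewrite mem_monos => /andP[]. Qed.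

Lemma bmon_uniq n d x : uniq x -> {subset x <= monos n d} -> uniq (map (bmon n) x).
Proof.
move=> ux xM; rewrite map_inj_in_uniq //.
by move=> b c /xM/monos_size + /xM/monos_size; apply: bmon_inj.
Qed.

Lemma card_bset n d x :
  uniq x -> {subset x <= monos n d} -> #|` bset n x|%fset = size x.
Proof. by move=> ux xM; rewrite card_fseq undup_id ?size_map ?(bmon_uniq ux xM). Qed.

Lemma mdeg_bset n d x m :
  {subset x <= monos n d} -> m \in bset n x -> mdeg m = d.
Proof.
move=> xM; rewrite in_bset => /mapP[b /xM + ->].
by rewrite mem_monos => /andP[/eqP sb /eqP <-]; apply: mdeg_bmon.
Qed.

Lemma bset_cons n b x : bset n (b :: x) = (bmon n b |` bset n x)%fset.
Proof. by apply/fsetP => m; rewrite in_fset1U !in_bset inE. Qed.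

Lemma monomial_permM n (s t : 'S_n) m :
  monomial_perm s (monomial_perm t m) = monomial_perm (t * s)%g m.
Proof. by apply/mnmP => i; rewrite !mnmE invMg permM. Qed.

Lemma monomial_perm1 n (m : 'X_{1..n}) : monomial_perm 1%g m = m.
Proof. by apply/mnmP => i; rewrite mnmE invg1 perm1. Qed.

Lemma monomial_perm_inj n (s : 'S_n) : injective (monomial_perm s).
Proof.
apply: (@can_inj _ _ _ (monomial_perm s^-1%g)) => m.
by rewrite monomial_permM mulgV monomial_perm1.
Qed.

Lemma mdeg_monomial_perm n (s : 'S_n) m : mdeg (monomial_perm s m) = mdeg m.
Proof.
rewrite !mdegE (reindex_inj (@perm_inj _ s)) /=.
by apply: eq_bigr => i _; rewrite monomial_permE.
Qed.

Lemma square_free_monomial_perm n (s : 'S_n) (m : 'X_{1..n}) :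
  square_free m -> square_free (monomial_perm s m).
Proof.
move=> sfm i; apply: contra (sfm ((s^-1)%g i)) => /mnm_lepP le_i.
apply/mnm_lepP => j; have := le_i (s j); rewrite monomial_permE !mulmnE !mnm1E.
by rewrite -(inj_eq (@perm_inj _ s) (s^-1%g i)) permKV.
Qed.

Lemma mem_set_perm n (s : 'S_n) F m :
  (monomial_perm s m \in set_perm s F) = (m \in F).
Proof.
apply/imfsetP/idP => [[k /= Fk /monomial_perm_inj->]//|Fm].
by exists m.
Qed.

Lemma set_permM n (s t : 'S_n) F : set_perm s (set_perm t F) = set_perm (t * s)%g F.
Proof.
apply/fsetP => m; apply/imfsetP/imfsetP => /= [[k /imfsetP[l /= Fl ->] ->]|[l Fl ->]].
  by exists l; rewrite // monomial_permM.
by exists (monomial_perm t l); rewrite ?monomial_permM // mem_set_perm.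
Qed.

Lemma set_perm1 n (F : {fset 'X_{1..n}}) : set_perm 1%g F = F.
Proof.
by apply/fsetP => m; rewrite -[in LHS](monomial_perm1 m) mem_set_perm.
Qed.

Lemma card_set_perm n (s : 'S_n) F : #|` set_perm s F|%fset = #|` F|%fset.
Proof. by rewrite card_imfset //; apply: monomial_perm_inj. Qed.

Lemma perm_class_set_perm n (s : 'S_n) F : perm_class (set_perm s F) = perm_class F.
Proof.
apply/fsetP => G; apply/imfsetP/imfsetP => /= [[t _ ->]|[t _ ->]].
  by exists (s * t)%g; rewrite ?inE // set_permM.
by exists (s^-1 * t)%g; rewrite ?inE // set_permM mulKVg.
Qed.

Lemma perm_class_eqP n (F G : {fset 'X_{1..n}}) :
  reflect (exists s, G = set_perm s F) (perm_class F == perm_class G).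
Proof.
apply: (iffP eqP) => [eqFG|[s ->]]; last by rewrite perm_class_set_perm.
have : G \in perm_class G by apply/imfsetP; exists 1%g; rewrite ?inE // set_perm1.
by rewrite -eqFG => /imfsetP[s _ ->]; exists s.
Qed.

(** * Representatives of sets of square free monomials *)

Definition act (p : seq nat) (b : bitseq) : bitseq := [seq nth false b i | i <- p].

Lemma perm_iotaP n p :
  reflect (exists s : 'S_n, p = [seq val (s i) | i <- enum 'I_n])
          (p \in permutations (iota 0 n)).
Proof.
rewrite mem_permutations; apply: (iffP idP) => [perm_p|[s ->]].
  have sp : size p = n by rewrite (perm_size perm_p) size_iota.
  have lt_p (i : 'I_n) : (nth 0 p i < n)%N.
    by have := mem_nth 0%N (_ : i < size p)%N; rewrite (perm_mem perm_p) mem_iota sp; apply.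
  have inj_p : injective (fun i => Ordinal (lt_p i)).
    move=> i j /(congr1 val) /= /eqP; rewrite nth_uniq ?sp //; first by move/eqP/val_inj.
    by rewrite (perm_uniq perm_p) iota_uniq.
  exists (perm inj_p); apply: (@eq_from_nth _ 0%N) => [|i].
    by rewrite size_map size_enum_ord.
  rewrite sp => lt_i; rewrite (nth_map (Ordinal lt_i)) ?size_enum_ord // permE /=.
  by rewrite nth_enum_ord.
apply: uniq_perm; rewrite ?iota_uniq //.
  by rewrite map_inj_uniq ?enum_uniq // => i j /val_inj/perm_inj.
move=> i; rewrite mem_iota add0n; apply/mapP/idP => [[j _ ->]|lt_i]; first exact: ltn_ord.
by exists ((s^-1)%g (Ordinal lt_i)); rewrite ?mem_enum ?permKV.
Qed.

(** The inverse appears because [act] fetches entry [s i] into position [i], whereas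
    [monomial_perm s] sends exponent [i] to position [s i]. *)
Lemma bmon_act n (s : 'S_n) b :
  bmon n (act [seq val (s i) | i <- enum 'I_n] b) = monomial_perm s^-1 (bmon n b).
Proof.
apply/mnmP => i; rewrite !mnmE invgK /act -map_comp (nth_map i) ?size_enum_ord //=.
by rewrite nth_ord_enum.
Qed.

Lemma act_monos n d (s : 'S_n) b :
  b \in monos n d -> act [seq val (s i) | i <- enum 'I_n] b \in monos n d.
Proof.
rewrite !mem_monos => /andP[/eqP sb /eqP cb].
have sa : size (act [seq val (s i) | i <- enum 'I_n] b) = n.
  by rewrite 2!size_map size_enum_ord.
by rewrite sa -(mdeg_bmon sa) bmon_act mdeg_monomial_perm mdeg_bmon // cb !eqxx.
Qed.

(** With monomials as edges of a hypergraph on the variables, these are the vertex degrees; a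
    permutation of the variables permutes them. *)
Definition degrees n (x : seq bitseq) : seq nat :=
  [seq count (nth false ^~ i) x | i <- iota 0 n].

Definition maps_to (x y : seq bitseq) (dx dy : seq nat) p :=
  (map (nth 0%N dx) p == dy) && all (fun b => act p b \in y) x.

Section Equivalence.
Variables (n : nat) (P : seq (seq nat)).
Hypothesis P_def : P =i permutations (iota 0 n).

(* The comparisons of degrees are redundant: they only speed up evaluation. *)
Definition equivb x y :=
  let dx := degrees n x in
  let dy := degrees n y in
  (sort leq dx == sort leq dy) && has (maps_to x y dx dy) P.

Lemma equivbP (d : nat) (x y : seq bitseq) :
    uniq x -> {subset x <= monos n d} -> uniq y -> {subset y <= monos n d} ->
    size x = size y ->
  reflect (exists s, bset n y = set_perm s (bset n x)) (equivb x y).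
Proof.
move=> ux xM uy yM sxy; apply: (iffP idP) => [/andP[_ /hasP[p]]|[s Ey]].
  rewrite P_def => /perm_iotaP[s ->] /andP[_ /allP xy]; exists (s^-1)%g.
  (* Both sets have the same cardinality, so one inclusion gives equality. *)
  have sub : (set_perm s^-1 (bset n x) `<=` bset n y)%fset.
    apply/fsubsetP => m /imfsetP[k /= + ->]; rewrite in_bset => /mapP[b xb ->].
    by rewrite -bmon_act in_bset map_f // xy.
  apply/esym/eqP; rewrite eqEfcard sub card_set_perm.
  by rewrite (card_bset ux xM) (card_bset uy yM) sxy leqnn.
pose t := (s^-1)%g; pose p := [seq val (t i) | i <- enum 'I_n].
have perm_p : perm_eq p (iota 0 n).
  by rewrite -mem_permutations; apply/perm_iotaP; exists t.
have act_xy b : b \in x -> act p b \in y.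
  move=> xb; have : bmon n (act p b) \in bset n y.
    by rewrite bmon_act invgK Ey mem_set_perm in_bset map_f.
  rewrite in_bset => /mapP[c yc]; move/bmon_inj => -> //.
    exact: monos_size (act_monos t (xM b xb)).
  exact: monos_size (yM c yc).
have perm_xy : perm_eq (map (act p) x) y.
  have uax : uniq (map (act p) x).
    rewrite map_inj_in_uniq // => b c xb xc /(congr1 (bmon n)).
    rewrite !bmon_act => /monomial_perm_inj /bmon_inj -> //.
      exact: monos_size (xM b xb).
    exact: monos_size (xM c xc).
  have [||_ eq_xy] := uniq_min_size uax (_ : {subset _ <= y}).
  - by move=> _ /mapP[b xb ->]; apply: act_xy.
  - by rewrite size_map sxy.
  - exact: uniq_perm.
(* Variable [i] occurs in the images under [act p] as often as variable [p_i] occurs in [x]. *)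
have deg_xy : map (nth 0%N (degrees n x)) p = degrees n y.
  apply: (@eq_from_nth _ 0%N); first by rewrite size_map size_map size_enum_ord size_map size_iota.
  move=> i; rewrite size_map size_map size_enum_ord => lt_i.
  have sp : size p = n by rewrite size_map size_enum_ord.
  have lt_pi : (nth 0 p i < n)%N.
    have : nth 0%N p i \in iota 0 n by rewrite -(perm_mem perm_p) mem_nth ?sp.
    by rewrite mem_iota.
  rewrite (nth_map 0%N) ?sp // !(nth_map 0%N) ?size_iota // !nth_iota // !add0n.
  rewrite -(seq.permP perm_xy) count_map; apply: eq_count => b /=.
  by rewrite (nth_map 0%N) ?sp.
apply/andP; split.
  rewrite -deg_xy; apply/eqP/perm_sortP; [exact: leq_total|exact: leq_trans|exact: anti_leq|].
  have := perm_map (nth 0%N (degrees n x)) perm_p.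
  have sx : size (degrees n x) = n by rewrite size_map size_iota.
  by rewrite map_nth_iota0 ?sx // take_oversize ?sx // perm_sym.
apply/hasP; exists p; first by rewrite P_def mem_permutations.
by rewrite /maps_to deg_xy eqxx; apply/allP.
Qed.

Fixpoint reduce (l : seq (seq bitseq)) :=
  if l is x :: l' then
    let r := reduce l' in if has (equivb x) r then r else x :: r
  else [::].

Lemma reduceS l : {subset reduce l <= l}.
Proof.
elim: l => [//|x l IH] y /=; case: ifP => _; rewrite !inE.
  by move/IH->; rewrite orbT.
by case/orP=> [->//|/IH->]; rewrite orbT.
Qed.

Lemma reduce_has l x : x \in l -> x \in reduce l \/ has (equivb x) (reduce l).
Proof.
elim: l => [//|y l IH] /=; rewrite inE => /predU1P[->|/IH].
  by case: ifP => [has_y|_]; [right|left; rewrite mem_head].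
case: ifP => _ [rx|has_x]; try by [left | right].
  by left; rewrite inE rx orbT.
by right; rewrite /= has_x orbT.
Qed.

Definition extend d (l : seq (seq bitseq)) :=
  [seq b :: x | x <- l, b <- [seq b <- monos n d | b \notin x]].

Fixpoint reps d k : seq (seq bitseq) :=
  if k is j.+1 then reduce (extend d (reps d j)) else [:: [::]].

Lemma extendP d l y :
  reflect (exists b x, [/\ x \in l, b \in monos n d, b \notin x & y = b :: x])
          (y \in extend d l).
Proof.
apply: (iffP allpairsPdep) => [[x [b [lx]]]|[b [x [lx bM xb ->]]]].
  by rewrite mem_filter => /andP[xb bM] ->; exists b, x.
by exists x, b; rewrite mem_filter xb.
Qed.

Lemma reps_monos d k x :
  x \in reps d k -> [/\ uniq x, size x = k & {subset x <= monos n d}].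
Proof.
elim: k x => [|k IH] x /=; first by rewrite inE => /eqP->.
move/reduceS/extendP => [b [y [/IH[uy sy yM] bM yb ->]]].
rewrite /= yb uy sy; split=> // c; rewrite inE => /predU1P[->//|]; exact: yM.
Qed.

(** Remove a monomial [m] from F: some [s] carries the rest to a representative [x]. The same [s]
    carries [m] to a monomial [b] outside [x], so [b :: x] is among the extensions, and [reduce]
    keeps it or something equivalent to it. *)
Lemma reps_complete d k (F : {fset 'X_{1..n}}) :
    #|` F|%fset = k -> {in F, forall m, square_free m} ->
    {in F, forall m, mdeg m = d} ->
  exists2 x, x \in reps d k & exists s, bset n x = set_perm s F.
Proof.
elim: k F => [|k IH] F cF sfF dF.
  exists [::]; rewrite ?mem_head //; exists 1%g.
  by rewrite set_perm1 (cardfs0_eq cF); apply/fsetP => m; rewrite in_bset in_fset0.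
have [m Fm] : exists m, m \in F by apply/fset0Pn; rewrite -cardfs_gt0 cF.
have [|k1 /fsetD1P[_ /sfF//]|k1 /fsetD1P[_ /dF//]|x xreps [s Ex]] := IH (F `\ m)%fset.
  by move: cF; rewrite (cardfsD1 m) Fm => -[].
have [b bM Eb] : exists2 b, b \in monos n d & monomial_perm s m = bmon n b.
  apply: square_freeP; first exact/square_free_monomial_perm/sfF.
  by rewrite mdeg_monomial_perm dF.
have Ebx : bset n (b :: x) = set_perm s F.
  by rewrite bset_cons Ex -Eb -{2}(fsetD1K Fm) /set_perm imfsetU1.
have xb : b \notin x.
  apply/negP => xb; have : monomial_perm s m \in bset n x by rewrite Eb in_bset map_f.
  by rewrite Ex mem_set_perm in_fsetD1 eqxx.
have ext_bx : b :: x \in extend d (reps d k) by apply/extendP; exists b, x.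
have [bx_red|/hasP[y y_red]] := reduce_has ext_bx; first by exists (b :: x); last exists s.
have [ux sx xM] := reps_monos xreps; have [uy sy yM] := @reps_monos d k.+1 y y_red.
case/(@equivbP d).
- by rewrite /= xb.
- by move=> c; rewrite inE => /predU1P[->//|]; exact: xM.
- by [].
- by [].
- by rewrite sy /= sx.
by move=> t Ey; exists y => //; exists (s * t)%g; rewrite Ey Ebx set_permM.
Qed.

End Equivalence.

(** * Cremona sets *)

(** Replacing the first bit by 1 reproduces column 0 of [exponent_mx]; absolute value 1
    characterizes the units of the integers. *)
Definition unimodular n (x : seq bitseq) : bool :=
  `|seq_det n [seq 1%:Z :: [seq (nat_of_bool c)%:Z | c <- behead b] | b <- x]|%N == 1%N.

Lemma unimodularP n d x :
  size x = n.+1 -> {subset x <= monos n.+1 d} ->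
  unimodular n.+1 x = (exponent_mx (map (bmon n.+1) x) \in unitmx).
Proof.
move=> sx xM; rewrite unitmxE /unimodular; set a := map _ _.
have sz i : (i < n.+1)%N -> size (nth [::] x i) = n.+1.
  by move=> lt_i; apply/eqP/(monos_size (xM _ (mem_nth _ _))); rewrite sx.
rewrite seq_detE ?size_map //; last first.
  apply/allP => _ /mapP[b /xM/monos_size/eqP sb ->].
  by rewrite /= size_map size_behead sb.
set A := \matrix_(i, j) _; have -> : A = exponent_mx (map (bmon n.+1) x).
  apply/matrixP => i j; rewrite !mxE !(nth_map [::]) ?sx // mnmE.
  case: (unliftP ord0 j) => [k ->|->//]; rewrite lift0 eq_sym (negPf (neq_lift _ _)) /=.
  by rewrite (nth_map false) ?nth_behead // size_behead sz.
by case: (\det _) => [[|[|m]]|[|m]].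
Qed.

Lemma square_free_cremonaP (K : fieldType) n d x :
    (0 < d)%N -> uniq x -> size x = n.+1 -> {subset x <= monos n.+1 d} ->
  cremona_set K (bset n.+1 x) <-> unimodular n.+1 x.
Proof.
move=> d_gt0 ux sx xM; rewrite (unimodularP sx xM).
have uX := bmon_uniq ux xM.
have dX : {in map (bmon n.+1) x, forall m, mdeg m = d}.
  by move=> m; rewrite -in_bset; apply: mdeg_bset.
have latticeP := lattice_exponent_mx uX (etrans (size_map _ _) sx) d_gt0 dX.
have cF : #|` bset n.+1 x|%fset = n.+1 by rewrite (card_bset ux xM).
have veroneseP := frac_field_veroneseP K uX dX.
split=> [[_ [e [_ eF eqF]]]|M_unit].
  (* The degree [e] supplied by [cremona_set] is identified with [d] on one member of the nonempty
     set. *)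
  have x0 : bmon n.+1 (nth [::] x 0) \in map (bmon n.+1) x.
    by rewrite map_f // mem_nth ?sx.
  have e_d : e = d by rewrite -(dX _ x0) -(eF (bmon n.+1 (nth [::] x 0))) ?in_bset.
  by apply/latticeP/veroneseP; rewrite -e_d.
split=> //; exists d; split=> // [m|]; first by rewrite in_bset => /dX.
exact/veroneseP/latticeP.
Qed.

(** Degrees 1 to [n] suffice: a square free monomial in [n] variables has degree at most [n]. *)
Definition cremona_reps n P : seq (seq bitseq) :=
  [seq x <- flatten [seq reps n P d n | d <- iota 1 n] | unimodular n x].

Lemma cremona_reps_monos n P x : x \in cremona_reps n P ->
  exists2 d, (0 < d)%N & [/\ uniq x, size x = n & {subset x <= monos n d}].
Proof.
rewrite mem_filter => /andP[_ /flatten_mapP[d]]; rewrite mem_iota => /andP[d_gt0 _].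
by move/reps_monos; exists d.
Qed.

Lemma nat_comb_perm n (t : 'S_n) s c :
  monomial_perm t (nat_comb s c) =
  nat_comb (map (monomial_perm t) s) (c \o monomial_perm t^-1%g).
Proof.
apply/mnmP => i; rewrite mnmE !nat_combE big_map; apply: eq_bigr => m _ /=.
by rewrite monomial_permM mulgV monomial_perm1 mnmE.
Qed.

Lemma monomial_permD n (t : 'S_n) m1 m2 :
  monomial_perm t (m1 + m2)%MM = (monomial_perm t m1 + monomial_perm t m2)%MM.
Proof. by apply/mnmP => i; rewrite mnmDE !mnmE. Qed.

(** Invariance is read off the lattice criterion: a relation for the monomial moved back by [t^-1]
    is transported by [t], with no automorphism of the fraction field involved. *)
Lemma set_perm_cremona K n (t : 'S_n) F :
  cremona_set K F -> cremona_set K (set_perm t F).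
Proof.
pose s := enum_fset F; have F_s : F = [fset m in s]%fset by apply/fsetP => m; rewrite in_fset.
have tF_s : set_perm t F = [fset m in map (monomial_perm t) s]%fset.
  apply/fsetP => m; rewrite in_fset; apply/imfsetP/mapP => -[k /= Fk ->];
  by exists k.
case=> [cF [d [d_gt0 dF eqF]]]; split; first by rewrite card_set_perm.
have us : uniq (map (monomial_perm t) s).
  by rewrite map_inj_uniq ?fset_uniq //; apply: monomial_perm_inj.
have ds : {in map (monomial_perm t) s, forall m, mdeg m = d}.
  by move=> _ /mapP[m sm ->]; rewrite mdeg_monomial_perm dF.
exists d; split=> // [m|]; first by rewrite tF_s in_fset => /ds.
rewrite tF_s; apply/(frac_field_veroneseP K us ds) => m dm.
move: eqF; rewrite {1}F_s => /(frac_field_veroneseP K (fset_uniq F) dF) comb.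
have [|a [b Eab]] := comb (monomial_perm t^-1%g m); first by rewrite mdeg_monomial_perm.
exists (a \o monomial_perm t^-1%g), (b \o monomial_perm t^-1%g).
rewrite -!nat_comb_perm -Eab monomial_permD monomial_permM mulVg.
by rewrite monomial_perm1.
Qed.

(** Completeness of the representatives shows that every class is listed. Pairwise inequivalence,
    which makes the count exact, is a hypothesis to be checked by evaluation on the concrete
    list. *)
Lemma square_free_cremona_classes (K : fieldType) n P :
    P =i permutations (iota 0 n.+1) ->
    pairwise (fun x y => ~~ equivb n.+1 P x y) (cremona_reps n.+1 P) ->
  exists C : {fset {fset {fset 'X_{1..n.+1}}}},
    (forall c, c \in C <-> square_free_cremona_class K c) /\
    #|` C|%fset = size (cremona_reps n.+1 P).
Proof.
move=> P_def; set R := cremona_reps _ _ => neqR.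
pose cls x := perm_class (bset n.+1 x).
exists [fset c in map cls R]%fset; split=> [c|].
  rewrite in_fset; split=> [/mapP[x Rx ->]|[F [cremF sfF ->]]].
    have [d d_gt0 [ux sx xM]] := cremona_reps_monos Rx.
    exists (bset n.+1 x); split=> // [|m].
      apply/(square_free_cremonaP K d_gt0 ux sx xM).
      by move: Rx; rewrite mem_filter => /andP[].
    by rewrite in_bset => /mapP[b _ ->]; apply: square_free_bmon.
  have [cF [d [d_gt0 dF _]]] := cremF.
  have [x x_reps [s Ex]] := reps_complete P_def cF sfF dF.
  have [ux sx xM] := reps_monos x_reps.
  apply/mapP; exists x; last by rewrite /cls Ex perm_class_set_perm.
  rewrite mem_filter; apply/andP; split.
    by apply/(square_free_cremonaP K d_gt0 ux sx xM); rewrite Ex; apply: set_perm_cremona.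
  apply/flatten_mapP; exists d; rewrite // mem_iota d_gt0 add1n ltnS.
  have /xM : nth [::] x 0 \in x by rewrite mem_nth ?sx.
  by rewrite mem_monos => /andP[/eqP <- /eqP <-]; apply: count_size.
rewrite card_fseq undup_id ?size_map // uniq_pairwise pairwise_map.
have allR : all (mem R) R by apply/allP.
apply: sub_in_pairwise allR neqR => x y Rx Ry; apply: contra => /perm_class_eqP[s Es].
have [d _ [ux sx xM]] := cremona_reps_monos Rx.
have [e _ [uy sy yM]] := cremona_reps_monos Ry.
have x0 : bmon n.+1 (nth [::] x 0) \in bset n.+1 x.
  by rewrite in_bset map_f // mem_nth ?sx.
(* [equivbP] compares sets of one common degree, and permuting variables preserves degrees. *)
have e_d : e = d.
  rewrite -(mdeg_bset xM x0) -(mdeg_monomial_perm s); apply/esym/(mdeg_bset yM).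
  by rewrite Es mem_set_perm.
rewrite e_d in yM; apply/(equivbP P_def ux xM uy yM); first by rewrite sx sy.
by exists s.
Qed.

(** * Evaluation in six variables *)

Definition perms6 := permutations (iota 0 6).

Lemma cremona_reps6 :
  let R := cremona_reps 6 perms6 in
  (size R == 58%N) && pairwise (fun x y => ~~ equivb 6 perms6 x y) R.
Proof.
(* Left to lazy conversion at Qed: the virtual machine would evaluate both
   arguments of every [&&], so that [has] and [all] would not stop early. *)
exact_no_check (erefl true).
Qed.

Local Close Scope ring_scope.

Theorem theorem15 (K : fieldType) :
  exists C : {fset {fset {fset 'X_{1..6}}}},
    (forall c : {fset {fset 'X_{1..6}}},
        c \in C <-> square_free_cremona_class K c) /\
    #|` C|%fset = 58.
Proof.
have /andP[/eqP <- neqR] := cremona_reps6.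
by apply: square_free_cremona_classes neqR.
Qed.
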